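(* For all $k\ge 1$, (i) $\displaystyle \mathfrak E_{[2k-1]}(x)=\frac12\bigl(R_{2k-1}(x)+xR_{k-1}(x^2)+1\bigr)$ and $\displaystyle \mathfrak E_{[2k]}(x)=\frac12\left(R_{2k}(x)+\frac{(1+xR_k(x^2))R_k(x^2)}{1+x^2R_k^2(x^2)}\right)$; (ii) $\displaystyle \mathfrak O_{[2k-1]}(x)=\frac12\bigl(R_{2k-1}(x)-xR_{k-1}(x^2)-1\bigr)$ and $\displaystyle \mathfrak O_{[2k]}(x)=\frac12\left(R_{2k}(x)-\frac{(1+xR_k(x^2))R_k(x^2)}{1+x^2R_k^2(x^2)}\right)$.
   Context: $\mathfrak S_n$ is the set of permutations of $\{1,\dots,n\}$ (for $n=0$, the empty permutation, which is even). A permutation avoids a pattern $\tau\in\mathfrak S_k$ if none of its length-$k$ subsequences is order-isomorphic to $\tau$. $[k]$ denotes the pattern $12\ldots k$. $\mathfrak E_\tau(x)$ (resp. $\mathfrak O_\tau(x)$) is the ordinary generating function $\sum_{n\ge0}a_nx^n$ where $a_n$ is the number of even (resp. odd) permutations in $\mathfrak S_n$ avoiding both $132$ and $\tau$. $U_r$ is the Chebyshev polynomial of the second kind: $U_0(t)=1$, $U_1(t)=2t$, $U_r(t)=2tU_{r-1}(t)-U_{r-2}(t)$. For $k\ge1$, $R_k(x)=\dfrac{U_{k-1}\left(\frac1{2\sqrt x}\right)}{\sqrt x\,U_k\left(\frac1{2\sqrt x}\right)}$, a rational function of $x$, and $R_0(x)=0$; thus $R_1(x)=1$ and $R_k(x)=1/(1-xR_{k-1}(x))$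 for $k\ge1$. $R_k^2(x^2)$ means $(R_k(x^2))^2$. *)

(* Defs.v *)
From HB Require Import structures.
From mathcomp Require Import all_boot all_order all_fingroup all_algebra.
From mathcomp Require Import boolp.

Set Implicit Arguments.
Unset Strict Implicit.
Unset Printing Implicit Defensive.

Import GRing.Theory.
Local Open Scope ring_scope.

Section FormalPowerSeries.

Variable R : idomainType.

Record fps := Fps { fcoef : nat -> R }.

Lemma fpsP (f g : fps) : fcoef f =1 fcoef g -> f = g.
Proof. by case: f g => [f] [g] /= /funext ->. Qed.

HB.instance Definition _ := gen_eqMixin fps.
HB.instance Definition _ := gen_choiceMixin fps.

Implicit Types f g h : fps.

Definition fps_zero : fps := Fps (fun=> 0).
Definition fps_opp f : fps := Fps (fun n => - fcoef f n).
Definition fps_add f g : fps := Fps (fun n => fcoef f n + fcoef g n).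
Definition fps_one : fps := Fps (fun n => (n == 0%N)%:R).
Definition fps_mul f g : fps :=
  Fps (fun n => \sum_(i < n.+1) fcoef f i * fcoef g (n - i)%N).

Fact fps_addA : associative fps_add.
Proof. by move=> f g h; apply: fpsP => n /=; rewrite addrA. Qed.

Fact fps_addC : commutative fps_add.
Proof. by move=> f g; apply: fpsP => n /=; rewrite addrC. Qed.

Fact fps_add0 : left_id fps_zero fps_add.
Proof. by move=> f; apply: fpsP => n /=; rewrite add0r. Qed.

Fact fps_addN : left_inverse fps_zero fps_opp fps_add.
Proof. by move=> f; apply: fpsP => n /=; rewrite addNr. Qed.

HB.instance Definition _ :=
  GRing.isZmodule.Build fps fps_addA fps_addC fps_add0 fps_addN.

Definition fps_trunc N f : {poly R} := \poly_(i < N) fcoef f i.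

Fact fps_mul_trunc N f g n : (n < N)%N ->
  fcoef (fps_mul f g) n = (fps_trunc N f * fps_trunc N g)`_n.
Proof.
move=> ltnN; rewrite coefM; apply: eq_bigr => i _.
have leiN : (i < N)%N by apply: leq_ltn_trans ltnN; rewrite -ltnS.
by rewrite !coef_poly leiN (leq_ltn_trans (leq_subr _ _) ltnN).
Qed.

Fact fps_mulC : commutative fps_mul.
Proof.
by move=> f g; apply: fpsP => n; rewrite !(fps_mul_trunc _ _ (ltnSn n)) mulrC.
Qed.

Fact fps_mulA : associative fps_mul.
Proof.
move=> f g h; apply: fpsP => n; pose t := fps_trunc n.+1.
have ltn (i : 'I_n.+1) : (n - i < n.+1)%N by rewrite ltnS leq_subr.
transitivity (t f * (t g * t h))`_n.
  rewrite coefM /=; apply: eq_bigr => i _.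
  by rewrite -(fps_mul_trunc _ _ (ltn i)) coef_poly ltn_ord.
rewrite mulrA coefM /=; apply: eq_bigr => i _.
by rewrite -(fps_mul_trunc _ _ (ltn_ord i)) coef_poly ltn.
Qed.

Fact fps_mul1 : left_id fps_one fps_mul.
Proof.
move=> f; apply: fpsP => n /=; rewrite big_ord_recl /= mul1r subn0.
by rewrite big1 ?addr0 // => i _; rewrite mul0r.
Qed.

Fact fps_mulDl : left_distributive fps_mul fps_add.
Proof.
move=> f g h; apply: fpsP => n /=; rewrite -big_split /=.
by apply: eq_bigr => i _; rewrite mulrDl.
Qed.

Fact fps_one_neq0 : fps_one != 0.
Proof.
apply/eqP => /(congr1 (fun f => fcoef f 0)) /= /eqP.
by rewrite oner_eq0.
Qed.

HB.instance Definition _ := GRing.Zmodule_isComNzRing.Build fps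
  fps_mulA fps_mulC fps_mul1 fps_mulDl fps_one_neq0.

Definition fps_unit : pred fps := fun f => `[< exists g, g * f = 1 >].
Definition fps_inv f : fps :=
  if pselect (exists g, g * f = 1) is left fU then sval (cid fU) else f.

Fact fps_mulV : {in fps_unit, left_inverse 1 fps_inv *%R}.
Proof.
move=> f /asboolP fU; rewrite /fps_inv; case: pselect => // fU'.
exact: svalP (cid fU').
Qed.

Fact fps_unitP f g : g * f = 1 -> fps_unit f.
Proof. by move=> gf1; apply/asboolP; exists g. Qed.

Fact fps_inv_out : {in [predC fps_unit], fps_inv =1 id}.
Proof.
move=> f /negP fNU; rewrite /fps_inv; case: pselect => // fU.
by case: fNU; apply/asboolP.
Qed.

HB.instance Definition _ := GRing.ComNzRing_hasMulInverse.Build fps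
  fps_mulV fps_unitP fps_inv_out.

Fact fps_order f : f != 0 ->
  exists2 m, fcoef f m != 0 & forall i, (i < m)%N -> fcoef f i = 0.
Proof.
move=> fN0; have exf : exists m, fcoef f m != 0.
  apply: contrapT => f0; case/eqP: fN0; apply: fpsP => n /=.
  by apply/eqP/negPn/negP => fn; apply: f0; exists n.
case: (ex_minnP exf) => m fm minm; exists m => // i ltim.
by apply/eqP/negPn/negP => /minm; rewrite leqNgt ltim.
Qed.

Fact fps_idomain f g : f * g = 0 -> (f == 0) || (g == 0).
Proof.
move=> fg0; apply/norP => -[/fps_order[m fm f0] /fps_order[p gp g0]].
move: (congr1 (fun h => fcoef h (m + p)%N) fg0) => /= /eqP.
have ltm : (m < (m + p).+1)%N by rewrite ltnS leq_addr.
rewrite (bigD1 (Ordinal ltm)) //= addKn big1 ?addr0.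
  by rewrite mulf_eq0 (negPf fm) (negPf gp).
move=> i; rewrite -val_eqE /= neq_ltn => /orP[ltim|ltmi].
  by rewrite f0 ?mul0r.
by rewrite g0 ?mulr0 // ltn_subLR ?ltn_add2r // -ltnS.
Qed.

HB.instance Definition _ :=
  GRing.ComUnitRing_isIntegral.Build fps fps_idomain.

End FormalPowerSeries.

(* The field Q((sqrt x)): fractions of formal power series whose variable is
   sqrt x. It contains Q[[x]] (even power series) and 1 / (2 sqrt x). *)
Definition K : Type := {fraction fps rat}.
HB.instance Definition _ := GRing.Field.on K.

Definition sqrtx : K := tofrac (Fps (fun n => (n == 1%N)%:R)).
Definition x : K := sqrtx ^+ 2.

(* sum_n a_n x^n, whose coefficient on (sqrt x)^(2n) is a_n. *)
Definition ogf (a : nat -> nat) : K :=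
  tofrac (Fps (fun n => if odd n then 0 else (a n./2)%:R)).

Fixpoint chebU (F : nzRingType) (r : nat) : {poly F} :=
  match r with
  | 0 => 1
  | r'.+1 => if r' is r''.+1
             then 2%:R *: 'X * chebU F r' - chebU F r''
             else 2%:R *: 'X
  end.

(* An arbitrary choice between the two square roots of z, when there is one. *)
Definition sqroot (F : fieldType) (z : F) : F :=
  if pselect (exists w : F, w ^+ 2 = z) is left zsq then sval (cid zsq) else 0.

(* R_k(z) for z having a square root in F, such as x and x ^+ 2 in K; the choice
   of the root is immaterial since U_r(-t) = (-1)^r U_r(t). *)
Definition chebR (F : fieldType) (k : nat) (z : F) : F :=
  if k is k'.+1 then
    let t := (2%:R * sqroot z)^-1 in
    (chebU F k').[t] / (sqroot z * (chebU F k).[t])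
  else 0.

Definition contains (k n : nat) (tau : 'S_k) (s : 'S_n) : bool :=
  [exists f : {ffun 'I_k -> 'I_n},
    [forall i : 'I_k, forall j : 'I_k, (i < j)%N ==> (f i < f j)%N] &&
    [forall i : 'I_k, forall j : 'I_k,
       (s (f i) < s (f j))%N == (tau i < tau j)%N]].

Definition avoids (k n : nat) (tau : 'S_k) (s : 'S_n) : bool :=
  ~~ contains tau s.

(* 132 in the 0-based notation 0 2 1. *)
Definition pat132 : 'S_3 := tperm (inord 1) (inord 2).

Definition idpat (k : nat) : 'S_k := 1%g.

Definition even_count (k : nat) (tau : 'S_k) (n : nat) : nat :=
  #|[set s : 'S_n | [&& ~~ odd_perm s, avoids pat132 s & avoids tau s]]|.

Definition odd_count (k : nat) (tau : 'S_k) (n : nat) : nat :=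
  #|[set s : 'S_n | [&& odd_perm s, avoids pat132 s & avoids tau s]]|.

Definition even_gf (k : nat) (tau : 'S_k) : K := ogf (even_count tau).
Definition odd_gf (k : nat) (tau : 'S_k) : K := ogf (odd_count tau).

(* Main.v *)
Require Import Defs.
From mathcomp Require Import all_boot all_order all_fingroup all_algebra.
From mathcomp Require Import boolp.
From mathcomp Require Import zify ring.

(** Cut a 132-avoiding permutation at its maximum, as [L n R]. Every entry of
    [L] exceeds every entry of [R], since otherwise some [a n c] with [a] in
    [L] and [c] in [R] is an occurrence of 132; conversely, any 132-avoiding
    [L] and [R], with [L] shifted above [R], give a 132-avoiding permutation.
    An increasing subsequence lives in [R], or in [L] followed by [n], so the
    result avoids [12...(k+1)] iff [L] avoids [12...k] and [R] avoids
    [12...(k+1)]. Besides the inversions inside [L] and [R] there are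
    [(|L| + 1) * |R|] of them. Hence the polynomials
    [m_k(n) = \sum_s e ^ (number of inversions of s)], over the avoiders [s] of
    size [n], satisfy (lemma [invgfSS])
      [m_(k+1)(n+1) = \sum_(i + j = n) e^((i+1) j) m_k(i) m_(k+1)(j)].

    For [e = 1] this is the functional equation [N' = 1 + x N N'] between
    consecutive generating functions, which is the recursion of [R_k(x)]
    (lemma [chebR_x]). For [e = -1] the sign depends only on the parities of
    [i] and [j], and the even and odd parts [A] and [B] of the series of
    [m_k], with the corresponding [A'] and [B'] of [m_(k+1)], are related by
      [A' = 1 + x (B A' - A B')]  and  [B' = x (A A' + B B')].
    Given [A] and [B] this is a linear system for [A'] and [B']. Two rounds of
    it starting at [A = 1] and [B = x rho] lead back to [A = 1], and replace
    [rho] by [1 / (1 - x^2 rho)] (lemma [parity_step]): this is the recursion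
    of [R_k(x^2)], so [1 + x R_(k-1)(x^2)] is the signed generating function of
    the avoiders of [12...(2k-1)], and the intermediate round gives that of
    the avoiders of [12...2k].

    The parity of a permutation is that of its number of inversions
    ([odd_perm_word]), so the even and odd counts are the half sum and the half
    difference of the cases [e = 1] and [e = -1]. *)

Set Implicit Arguments.
Unset Strict Implicit.
Unset Printing Implicit Defensive.

Import GRing.Theory.
Local Open Scope nat_scope.

(** * Patterns and inversions in words *)

Definition has132 (l : seq nat) : bool :=
  `[< exists a b c, subseq [:: a; b; c] l /\ a < c < b >].

Definition hasinc (k : nat) (l : seq nat) : bool :=
  `[< exists t, [/\ subseq t l, size t = k & sorted ltn t] >].

Fixpoint ninv (l : seq nat) : nat :=
  if l is a :: l' then count (fun b => b < a) l' + ninv l' else 0.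

(** Cutting a 132-avoiding permutation of [{0, ..., n}] at its maximum [n]
    puts it in this form, where [L] and [R] are again permutations of initial
    segments: the entries left of [n] exceed those right of it. *)
Definition comb (L R : seq nat) : seq nat :=
  map (addn (size R)) L ++ (size L + size R) :: R.

Lemma subseq_catP (T : eqType) (t l1 l2 : seq T) :
  subseq t (l1 ++ l2) ->
  exists t1 t2, [/\ t = t1 ++ t2, subseq t1 l1 & subseq t2 l2].
Proof.
case/subseqP => m; rewrite size_cat => szm ->.
exists (mask (take (size l1) m) l1), (mask (drop (size l1) m) l2).
rewrite !mask_subseq -mask_cat ?cat_take_drop // size_takel // szm.
exact: leq_addr.
Qed.

Lemma subseq_mapP (T U : eqType) (f : T -> U) t l :
  subseq t (map f l) -> exists2 t', t = map f t' & subseq t' l.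
Proof.
case/subseqP => m _ ->; exists (mask m l); first by rewrite map_mask.
exact: mask_subseq.
Qed.

Lemma has132_sub l l' : subseq l l' -> has132 l -> has132 l'.
Proof.
move=> sll' /asboolP [a [b [c [sl lt]]]]; apply/asboolP.
by exists a, b, c; split=> //; apply: subseq_trans sll'.
Qed.

Lemma hasinc_sub k l l' : subseq l l' -> hasinc k l -> hasinc k l'.
Proof.
move=> sll' /asboolP [t [sl szt st]]; apply/asboolP.
by exists t; split=> //; apply: subseq_trans sll'.
Qed.

Lemma hasinc_le j k l : j <= k -> hasinc k l -> hasinc j l.
Proof.
move=> lejk /asboolP [t [sl szt st]]; apply/asboolP; exists (take j t); split.
- exact: subseq_trans (take_subseq _ _) sl.
- by rewrite size_takel ?szt.
- exact: take_sorted.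
Qed.

Lemma sorted_shift m t : sorted ltn (map (addn m) t) = sorted ltn t.
Proof. by rewrite sorted_map; apply: eq_sorted => a b /=; rewrite ltn_add2l. Qed.

Lemma has132_shift m l : has132 (map (addn m) l) = has132 l.
Proof.
apply: asbool_equiv_eq; split=> [[a [b [c [/subseq_mapP[t e sl] lt]]]]|].
  case: t e sl => [|a' [|b' [|c' [|? ?]]]] //= [ea eb ec] sl.
  by exists a', b', c'; split=> //; lia.
move=> [a [b [c [sl lt]]]]; exists (m + a), (m + b), (m + c).
by split; [apply: (map_subseq (addn m) sl) | lia].
Qed.

Lemma hasinc_shift k m l : hasinc k (map (addn m) l) = hasinc k l.
Proof.
apply: asbool_equiv_eq; split=> [[t [/subseq_mapP[t' -> sl]]]|].
  by rewrite size_map sorted_shift => sz st; exists t'.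
move=> [t [sl sz st]]; exists (map (addn m) t).
by rewrite map_subseq // size_map sorted_shift.
Qed.

(** The shift makes every entry before the maximum larger than every entry
    after it, so that the outer two letters of an occurrence of 132 cannot be
    separated by the maximum. *)
Lemma has132_comb L R :
  all (fun b => b < size L) L -> all (fun b => b < size R) R ->
  has132 (comb L R) = has132 L || has132 R.
Proof.
move=> /allP ltL /allP ltR; apply/idP/orP; last first.
  rewrite /comb -(has132_shift (size R) L) => -[]; apply: has132_sub.
    exact: prefix_subseq.
  by apply: subseq_trans (suffix_subseq _ _); apply: subseq_cons.
have inL a : a \in map (addn (size R)) L -> size R <= a < size L + size R.
  by case/mapP=> b /ltL ltb ->; lia.
have inR a : a \in size L + size R :: R ->
    a = size L + size R \/ a < size R.
  by rewrite inE => /orP[/eqP|/ltR]; [left | right].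
case/asboolP=> a [b [c [/subseq_catP[t1 [t2 [e s1 s2]]] lt]]].
have m1 := mem_subseq s1; have m2 := mem_subseq s2.
case: t1 e s1 m1 => [|a1 [|b1 [|c1 t1]]] /=.
- move=> e _ _; rewrite -{t2}e /= in s2 m2.
  have := inR a (m2 a (mem_head _ _)).
  have /inR : c \in size L + size R :: R by apply: m2; rewrite !inE eqxx !orbT.
  case: eqP s2 => [ea|_ s2] hc ha; first by lia.
  by right; apply/asboolP; exists a, b, c.
- case=> <- e _ m1; rewrite -{t2}e in s2 m2.
  have := inL a (m1 a (mem_head _ _)); have := inR b (m2 b (mem_head _ _)).
  have /inR : c \in size L + size R :: R by apply: m2; rewrite !inE eqxx !orbT.
  by lia.
- case=> <- <- e _ m1; rewrite -{t2}e in s2 m2.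
  have := inL a (m1 a (mem_head _ _)); have := inR c (m2 c (mem_head _ _)).
  have /inL : b \in map (addn (size R)) L.
    by apply: m1; rewrite !inE eqxx !orbT.
  by lia.
case=> <- <- <- e; case: t1 e => [|//] _ s1 _; left.
by rewrite -(has132_shift (size R)); apply/asboolP; exists a, b, c.
Qed.

(** An increasing subsequence cannot step down from the entries before the
    maximum to the smaller entries after it. It therefore stays after the
    maximum, or it lies before it up to a last letter, which may be the maximum
    itself. *)
Lemma hasinc_comb k L R :
  all (fun b => b < size L) L -> all (fun b => b < size R) R ->
  hasinc k.+1 (comb L R) = hasinc k L || hasinc k.+1 R.
Proof.
move=> /allP ltL /allP ltR; apply/idP/orP; last first.
  case; last first.
    apply: hasinc_sub; apply: subseq_trans (suffix_subseq _ _).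
    exact: subseq_cons.
  case/asboolP=> t [sl sz st]; apply/asboolP.
  exists (map (addn (size R)) t ++ [:: size L + size R]); split.
  - apply: cat_subseq; first exact: map_subseq.
    by rewrite sub1seq inE eqxx.
  - by rewrite size_cat size_map sz addn1.
  rewrite (sorted_pairwise ltn_trans) pairwise_cat /= andbT.
  rewrite -(sorted_pairwise ltn_trans) sorted_shift st andbT.
  apply/allrelP => a b /mapP[c cL ->]; rewrite inE => /eqP ->.
  by move: (ltL c (mem_subseq sl cL)) => /= ?; lia.
case/asboolP=> t [/subseq_catP[t1 [t2 [-> s1 s2]]]].
rewrite size_cat (sorted_pairwise ltn_trans) pairwise_cat.
move=> sz /and3P[/allrelP lt12 st1 st2].
have small2 t3 a : subseq t3 R -> all (ltn a) t3 -> size R <= a -> t3 = [::].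
  case: t3 => [//|b t3] /mem_subseq /(_ b (mem_head _ _)) /ltR ltb /= /andP[].
  by move=> /= ltab _ lea; lia.
case: t1 s1 sz lt12 st1 => [|a t1] s1 sz lt12 st1.
  case: t2 s2 sz st2 {lt12} => [//|b t2] /=.
  case: eqP => [-> s2 [sz]|_ s2 sz st2].
    case/andP=> lt2 _; left; apply/asboolP; exists [::].
    by rewrite -sz (small2 _ _ s2 lt2) ?leq_addl // sub0seq.
  right; apply/asboolP; exists (b :: t2).
  by split; rewrite // (sorted_pairwise ltn_trans).
have lea : size R <= a.
  by have /mapP[b _ ->] := mem_subseq s1 (mem_head _ _); lia.
have lt2 : size t2 <= 1.
  case: t2 s2 lt12 {sz} st2 => [//|b t2] /= s2 lt12 st2.
  case: eqP s2 => [eb|nb] s2.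
    move: st2 => /andP[]; rewrite eb => st2 _.
    by rewrite (small2 _ _ s2 st2) //; lia.
  have /small2 : all (ltn a) (b :: t2).
    by apply/allP => c /(lt12 _ _ (mem_head _ _)).
  by move/(_ s2 lea).
left; rewrite -(hasinc_shift k (size R)) (@hasinc_le _ (size (a :: t1))) //.
  by move: sz lt2 => /=; lia.
by apply/asboolP; exists (a :: t1); rewrite (sorted_pairwise ltn_trans).
Qed.

Lemma ninv_cat l1 l2 :
  ninv (l1 ++ l2) =
  ninv l1 + ninv l2 + sumn [seq count (fun b => b < a) l2 | a <- l1].
Proof.
elim: l1 => [|a l1 IH] /=; first by rewrite addn0.
by rewrite count_cat IH; lia.
Qed.

Lemma ninv_shift m l : ninv (map (addn m) l) = ninv l.
Proof.
elim: l => //= a l ->; congr (_ + _); rewrite count_map.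
by apply: eq_count => b /=; rewrite ltn_add2l.
Qed.

(** The letters of [L] and the maximum all form an inversion with each letter
    of [R]. *)
Lemma ninv_comb L R :
  all (fun b => b < size L) L -> all (fun b => b < size R) R ->
  ninv (comb L R) = ninv L + ninv R + (size L).+1 * size R.
Proof.
move=> /allP ltL ltR; rewrite /comb ninv_cat ninv_shift /=.
have cR a : size R <= a -> count (fun b => b < a) R = size R.
  move=> lea; apply/eqP; rewrite -all_count.
  by apply: sub_all ltR => b /= ltb; apply: leq_trans lea.
rewrite cR ?leq_addl // -map_comp.
rewrite (_ : map _ L = [seq size R | _ <- L]); last first.
  apply/eq_in_map => a /ltL /= lta; rewrite cR ?leq_addr //.
  by rewrite ltnNge [_ + a]addnC leq_add2r ltnW.
have -> : sumn [seq size R | _ <- L] = size L * size R.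
  by elim: (L) => //= _ l ->; rewrite mulSn.
by rewrite mulSn; lia.
Qed.

Lemma all_ltn_perm n l : perm_eq l (iota 0 n) ->
  size l = n /\ all (fun b => b < size l) l.
Proof.
move=> pl; have sz : size l = n by rewrite (perm_size pl) size_iota.
split=> //; apply/allP => b; rewrite (perm_mem pl) mem_iota sz; lia.
Qed.

Lemma perm_comb i j L R : perm_eq L (iota 0 i) -> perm_eq R (iota 0 j) ->
  perm_eq (comb L R) (iota 0 (i + j).+1).
Proof.
move=> pL pR; have [sL _] := all_ltn_perm pL; have [sR _] := all_ltn_perm pR.
rewrite /comb sL sR -addn1 iotaD perm_sym perm_catC perm_sym perm_catC /=.
rewrite add0n perm_cons addnC iotaD perm_cat //.
by rewrite add0n -[X in iota X]addn0 iotaDl perm_map.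
Qed.

(** If [a] before the maximum [n] were smaller than [c] after it, then [a n c]
    would be an occurrence of 132. So the letters after [n] are the smallest
    ones, and they fill an initial segment. *)
Lemma perm_combP n l : perm_eq l (iota 0 n.+1) -> ~~ has132 l ->
  exists L R, [/\ l = comb L R, size L + size R = n,
    perm_eq L (iota 0 (size L)) & perm_eq R (iota 0 (size R))].
Proof.
move=> pl no132.
have /splitPr el : n \in l by rewrite (perm_mem pl) mem_iota; lia.
case: el pl no132 => L R pl no132.
have ul : uniq (L ++ n :: R) by rewrite (perm_uniq pl) iota_uniq.
have pLR : perm_eq (R ++ L) (iota 0 n).
  rewrite -addn1 iotaD add0n perm_catC perm_sym perm_catC perm_sym in pl.
  by rewrite /= perm_cons in pl.
have szLR : size R + size L = n.
  by rewrite -size_cat (perm_size pLR) size_iota.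
have ltRL a c : a \in L -> c \in R -> c < a.
  move=> aL cR; rewrite ltnNge leq_eqVlt; apply/negP => /orP[/eqP eac|ltac].
    move: ul; rewrite cat_uniq => /and3P[_ /hasPn /(_ c)].
    by rewrite inE cR orbT -eac aL => /(_ isT).
  case/negP: no132; apply/asboolP; exists a, n, c; split.
    rewrite -[[:: a; n; c]]/([:: a] ++ [:: n; c]); apply: cat_subseq.
      by rewrite sub1seq.
    by rewrite /= eqxx sub1seq.
  rewrite ltac /=; have := perm_mem pLR c; rewrite mem_cat cR mem_iota.
  by lia.
(* Sorting both sides exhibits R as the first letters of iota 0 n, and L as
   the last ones. *)
have e : sort leq R ++ sort leq L = iota 0 n.
  apply: (sorted_eq leq_trans anti_leq).
  - rewrite (sorted_pairwise leq_trans) pairwise_cat.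
    rewrite -!(sorted_pairwise leq_trans) !sort_sorted; try exact: leq_total.
    rewrite !andbT; apply/allrelP => c a; rewrite !mem_sort => cR aL.
    exact/ltnW/ltRL.
  - exact: iota_sorted.
  - apply: perm_trans pLR.
    by apply: perm_cat; rewrite perm_sort.
have pR : perm_eq R (iota 0 (size R)).
  rewrite -(perm_sort leq R).
  have -> : sort leq R = take (size R) (iota 0 n).
    by rewrite -e take_size_cat // size_sort.
  by rewrite take_iota (minn_idPl _) // -szLR leq_addr.
have pL : perm_eq L (iota (size R) (size L)).
  rewrite -(perm_sort leq L).
  have -> : sort leq L = drop (size R) (iota 0 n).
    by rewrite -e drop_size_cat // size_sort.
  by rewrite drop_iota -szLR addKn.
exists (map (subn^~ (size R)) L), R.
have eL : map (addn (size R)) (map (subn^~ (size R)) L) = L.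
  rewrite -map_comp -[RHS]map_id; apply/eq_in_map => a.
  by rewrite (perm_mem pL) mem_iota => /andP[lea _] /=; rewrite subnKC.
split=> //; rewrite ?size_map; last 1 first.
- apply: (perm_map_inj (@addnI (size R))).
  by rewrite eL -iotaDl addn0.
- by rewrite /comb eL size_map addnC szLR.
- by rewrite addnC.
Qed.

(** * Decomposition of the avoiders at their maximum *)

Definition avoiders (k n : nat) : seq (seq nat) :=
  [seq l <- permutations (iota 0 n) | ~~ has132 l & ~~ hasinc k l].

Lemma mem_avoiders k n l :
  (l \in avoiders k n) = [&& perm_eq l (iota 0 n), ~~ has132 l & ~~ hasinc k l].
Proof. by rewrite mem_filter mem_permutations andbC. Qed.

Lemma avoidersP k n l : l \in avoiders k n ->
  [/\ size l = n, all (fun b => b < size l) l & perm_eq l (iota 0 n)].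
Proof.
by rewrite mem_avoiders => /and3P[pl _ _]; have [] := all_ltn_perm pl.
Qed.

Lemma avoiders_uniq k n : uniq (avoiders k n).
Proof. exact/filter_uniq/permutations_uniq. Qed.

Lemma comb_avoiders k n L R : size L + size R = n ->
  perm_eq L (iota 0 (size L)) -> perm_eq R (iota 0 (size R)) ->
  (comb L R \in avoiders k.+1 n.+1) =
  (L \in avoiders k (size L)) && (R \in avoiders k.+1 (size R)).
Proof.
move=> <- pL pR; have [_ aL] := all_ltn_perm pL; have [_ aR] := all_ltn_perm pR.
rewrite !mem_avoiders perm_comb // pL pR has132_comb // hasinc_comb //.
by rewrite !negb_or /= andbACA.
Qed.

(** The position of the maximum determines the size of [L]. *)
Lemma comb_inj L R L' R' :
  all (fun b => b < size L) L -> all (fun b => b < size R) R ->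
  all (fun b => b < size L') L' -> all (fun b => b < size R') R' ->
  comb L R = comb L' R' -> (L, R) = (L', R').
Proof.
move=> aL aR aL' aR' e.
have en : size L + size R = size L' + size R'.
  by have := congr1 size e; rewrite !size_cat /= !size_map; lia.
have indexn A B : all (fun b => b < size A) A ->
    index (size A + size B) (comb A B) = size A.
  move=> /allP aA; rewrite index_cat size_map /= eqxx addn0.
  by case: ifP => // /mapP[b /aA ltb]; lia.
have eL : size L = size L' by rewrite -(indexn L R) // -(indexn L' R') // e en.
have eR : size R = size R' by lia.
move/eqP: e; rewrite /comb eqseq_cat ?size_map // eR.
by rewrite eqseq_cons => /and3P[/eqP/(inj_map (@addnI _)) -> _ /eqP ->].
Qed.

Lemma perm_avoiders_comb k n :
  perm_eq (avoiders k.+1 n.+1)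
    [seq comb p.1 p.2 | i <- iota 0 n.+1,
       p <- [seq (L, R) | L <- avoiders k i, R <- avoiders k.+1 (n - i)]].
Proof.
apply: uniq_perm; first exact: avoiders_uniq.
  apply: allpairs_uniq_dep; first exact: iota_uniq.
    by move=> i _; apply: allpairs_uniq => [||[? ?] [? ?] _ _ //];
      apply: avoiders_uniq.
  move=> z z' /allpairsPdep [i [p [_ /allpairsP[[L R] [AL AR ->]] ->]]].
  case/allpairsPdep=> [i' [p' [_ /allpairsP[[L' R'] [AL' AR' ->]] ->]]].
  rewrite /= in AL AR AL' AR' *.
  have [sL aL _] := avoidersP AL; have [_ aR _] := avoidersP AR.
  have [sL' aL' _] := avoidersP AL'; have [_ aR' _] := avoidersP AR'.
  move/(comb_inj aL aR aL' aR') => -[eL eR].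
  by rewrite -sL -sL' eL eR.
move=> l; apply/idP/allpairsPdep.
  move=> Al; move: (Al); rewrite mem_avoiders => /and3P[pl no132 _].
  have [L [R [el eLR pL pR]]] := perm_combP pl no132.
  move: Al; rewrite el comb_avoiders // => /andP[AL AR].
  exists (size L), (L, R); split=> //; first by rewrite mem_iota; lia.
  apply/allpairsP; exists (L, R); split=> //=.
  by rewrite -eLR addKn.
case=> i [p [+ /allpairsP[[L R] [/= AL AR ->]] ->]].
rewrite mem_iota => lei /=.
have [sL _ pL] := avoidersP AL; have [sR _ pR] := avoidersP AR.
by rewrite comb_avoiders ?sL ?sR ?AL //; lia.
Qed.

(** * Enumeration by number of inversions *)

Section InversionEnumerator.
Local Open Scope ring_scope.
Variables (T : comNzRingType) (e : T).

Definition invgf (k n : nat) : T := \sum_(l <- avoiders k n) e ^+ ninv l.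

Lemma invgf0 n : invgf 0 n = 0.
Proof.
rewrite /invgf big_seq big1 // => l; rewrite mem_avoiders => /and3P[_ _ /asboolP].
by case; exists [::]; rewrite sub0seq.
Qed.

Lemma invgfS0 k : invgf k.+1 0 = 1.
Proof.
suff p0 : perm_eq (avoiders k.+1 0) [:: [::]].
  by rewrite /invgf (perm_big _ p0) big_seq1.
apply: uniq_perm; rewrite ?avoiders_uniq // => l.
rewrite mem_avoiders inE; apply/andP/eqP => [[/perm_nilP //]|->].
split=> //; apply/andP; split; apply/asboolP => -[].
  by move=> a [b [c []]].
by move=> t []; rewrite subseq0 => /eqP ->.
Qed.

(** The index [i] is the number of letters before the maximum. *)
Lemma invgfSS k n : invgf k.+1 n.+1 =
  \sum_(i < n.+1) e ^+ (i.+1 * (n - i)) * (invgf k i * invgf k.+1 (n - i)).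
Proof.
rewrite /invgf (perm_big _ (perm_avoiders_comb k n)) big_allpairs_dep.
rewrite -[X in iota 0 X]subn0 -/(index_iota 0 n.+1) big_mkord.
apply: eq_bigr => i _; rewrite big_allpairs_dep mulr_suml mulr_sumr.
apply: eq_big_seq => L /avoidersP[sL aL _]; rewrite mulr_sumr mulr_sumr.
apply: eq_big_seq => R /avoidersP[sR aR _].
by rewrite ninv_comb // sL sR !exprD mulrC mulrA.
Qed.

End InversionEnumerator.

(** * Permutations as words *)

Definition word (n : nat) (s : 'S_n) : seq nat :=
  [seq val (s i) | i <- enum 'I_n].

Lemma size_word n (s : 'S_n) : size (word s) = n.
Proof. by rewrite size_map size_enum_ord. Qed.

Lemma nth_word n (s : 'S_n) (i : 'I_n) : nth 0 (word s) i = s i.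
Proof. by rewrite (nth_map i) ?size_enum_ord // nth_ord_enum. Qed.

Lemma word_inj n : injective (@word n).
Proof.
by move=> s t e; apply/permP => i; apply: val_inj; rewrite /= -!nth_word e.
Qed.

Lemma perm_word n (s : 'S_n) : perm_eq (word s) (iota 0 n).
Proof.
rewrite -val_enum_ord /word (map_comp val s); apply: perm_map.
apply: uniq_perm => [||i]; rewrite ?enum_uniq //.
  by rewrite map_inj_uniq ?enum_uniq //; apply: perm_inj.
rewrite mem_enum; apply/mapP; exists (s^-1%g i); first by rewrite mem_enum.
by rewrite permKV.
Qed.

Lemma perm_words n :
  perm_eq [seq word s | s <- enum 'S_n] (permutations (iota 0 n)).
Proof.
have uw : uniq [seq word s | s <- enum 'S_n].
  by rewrite map_inj_uniq ?enum_uniq //; apply: word_inj.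
apply: uniq_perm; rewrite ?permutations_uniq //.
apply: (uniq_min_size uw _ _).2 => [l /mapP[s _ ->]|].
  by rewrite mem_permutations perm_word.
rewrite size_permutations ?iota_uniq // size_iota size_map -cardE.
by rewrite card_Sn.
Qed.

(** Removing the first letter [s 0] of the word removes [s 0] inversions, one
    for each smaller value, while [lift_perm 0 (s 0)] shifts the parity by
    [s 0]. *)
Lemma odd_perm_word n (s : 'S_n) : odd_perm s = odd (ninv (word s)).
Proof.
elim: n s => [|n IH] s.
  rewrite /word (_ : enum _ = [::]) /=; last by apply/size0nil/size_enum_ord.
  by rewrite (_ : s = 1%g) ?odd_perm1 //; apply/permP => -[].
(* The permutation obtained by deleting the first letter; the default value is
   never reached, since s is injective. *)
pose f i := odflt i (unlift (s ord0) (s (lift ord0 i))).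
have fP i : lift (s ord0) (f i) = s (lift ord0 i).
  rewrite /f; case: unliftP => [j -> //|/perm_inj/eqP].
  by rewrite eq_sym (negPf (neq_lift _ _)).
have f_inj : injective f.
  by move=> i j e; apply/(@lift_inj _ ord0)/(@perm_inj _ s); rewrite -!fP e.
have es : s = lift_perm ord0 (s ord0) (perm f_inj).
  apply/permP => i; case: (unliftP ord0 i) => [j ->|->].
    by rewrite lift_perm_lift permE fP.
  by rewrite lift_perm_id.
have -> : word s = val (s ord0) :: [seq bump (s ord0) b | b <- word (perm f_inj)].
  rewrite /word enum_ordSl /= -!map_comp; congr (_ :: _).
  by apply: eq_map => i /=; rewrite -fP permE.
rewrite {1}es odd_lift_perm IH /= oddD; congr (odd _ (+) odd _).
  rewrite count_map (seq.permP (perm_word (perm f_inj))).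
  rewrite (eq_count (a2 := fun b => b < 0 + s ord0)) => [|b]; last first.
    by rewrite /= /bump; lia.
  rewrite -size_filter filter_iota_ltn ?size_iota ?subn0 //.
  by rewrite -ltnS ltn_ord.
elim: (word _) => //= a l ->; congr (_ + _); rewrite count_map.
by apply: eq_count => b /=; rewrite /bump; lia.
Qed.

Lemma sorted_enum_ord n : sorted (fun i j : 'I_n => i < j) (enum 'I_n).
Proof.
by rewrite -(sorted_map (f := val) (e' := ltn)) val_enum_ord; apply: iota_ltn_sorted.
Qed.

(** The increasing map of positions in [contains] is traded for the subword
    that it selects. *)
Lemma containsP k n (tau : 'S_k) (s : 'S_n) :
  reflect (exists t, [/\ subseq t (word s), size t = k &
     forall i j : 'I_k, (nth 0 t i < nth 0 t j) = (tau i < tau j)])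
    (contains tau s).
Proof.
apply: (iffP existsP) => [[f /andP[/forallP fI /forallP fT]]|].
  pose idx := [seq val (f i) | i <- enum 'I_k].
  have sidx : sorted ltn idx.
    rewrite sorted_map; apply: sub_sorted (sorted_enum_ord k) => i j ltij.
    by have /forallP/(_ j)/implyP := fI i; apply.
  (* A strictly increasing list of positions is a filtering of all positions,
     hence it selects a subword. *)
  have eidx : idx = [seq b <- iota 0 n | b \in idx].
    apply: (irr_sorted_eq ltn_trans ltnn sidx).
      exact/(sorted_filter ltn_trans)/iota_ltn_sorted.
    move=> b; rewrite mem_filter mem_iota; case: (boolP (b \in idx)) => //.
    by case/mapP=> i _ ->; rewrite /= ltn_ord.
  exists [seq nth 0 (word s) b | b <- idx]; split.
  - rewrite -[X in subseq _ X](mkseq_nth 0) size_word; apply: map_subseq.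
    by rewrite eidx filter_subseq.
  - by rewrite 2!size_map size_enum_ord.
  have nthE (i : 'I_k) : nth 0 [seq nth 0 (word s) b | b <- idx] i = s (f i).
    rewrite -map_comp (nth_map i) ?size_enum_ord //= nth_ord_enum.
    exact: nth_word.
  by move=> i j; rewrite !nthE; have /forallP/(_ j)/eqP := fT i.
case=> t [/subseq_mapP[t' -> st'] sz tT].
have szt' : size t' == k by rewrite -sz size_map.
exists [ffun i => tnth (Tuple szt') i]; apply/andP; split.
  apply/forallP => i; apply/forallP => j; apply/implyP => ltij; rewrite !ffunE.
  pose x0 := tnth (Tuple szt') i; rewrite !(tnth_nth x0).
  apply: (sorted_ltn_nth (leT := fun i j : 'I_n => i < j)) => //.
  - by move=> ? ? ?; apply: ltn_trans.
  - apply: subseq_sorted st' (sorted_enum_ord n).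
    by move=> ? ? ?; apply: ltn_trans.
  - by rewrite inE (eqP szt').
  - by rewrite inE (eqP szt').
apply/forallP => i; apply/forallP => j; rewrite -tT !ffunE.
pose x0 := tnth (Tuple szt') i; rewrite !(tnth_nth x0).
by rewrite !(nth_map x0) ?(eqP szt').
Qed.

Lemma contains_idpat k n (s : 'S_n) : contains (idpat k) s = hasinc k (word s).
Proof.
apply/containsP/asboolP => -[t [sl sz tP]]; exists t; split=> //.
  apply/(sortedP 0) => i; rewrite sz => lti.
  by have := tP (Ordinal (ltnW lti)) (Ordinal lti); rewrite !perm1 /= ltnSn.
move=> i j; rewrite !perm1.
have h (a b : 'I_k) : a < b -> nth 0 t a < nth 0 t b.
  by move=> ltab; apply: (sorted_ltn_nth ltn_trans) => //; rewrite inE sz.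
case: (ltngtP i j) => [/h|/h|/val_inj ->]; rewrite ?ltnn //; lia.
Qed.

Lemma contains_pat132 n (s : 'S_n) : contains pat132 s = has132 (word s).
Proof.
have v0 : pat132 (inord 0) = 0 :> nat.
  by rewrite tpermD ?inordK // -val_eqE /= !inordK.
have v1 : pat132 (inord 1) = 2 :> nat by rewrite tpermL inordK.
have v2 : pat132 (inord 2) = 1 :> nat by rewrite tpermR inordK.
apply/containsP/asboolP => [[[|a [|b [|c [|? ?]]]] [sl // _ tP]]|].
  exists a, b, c; split=> //.
  have := tP (inord 0) (inord 2); have := tP (inord 2) (inord 1).
  by rewrite v0 v1 v2 !inordK //= => -> ->.
move=> [a [b [c [sl /andP[ltac ltcb]]]]]; exists [:: a; b; c]; split=> // i j.
have ord3 (m : 'I_3) : [\/ m = inord 0, m = inord 1 | m = inord 2].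
  rewrite -[m]inord_val; case: m => [[|[|[|//]]] ltm] /=.
  - exact: Or31.
  - exact: Or32.
  - exact: Or33.
by case: (ord3 i) => ->; case: (ord3 j) => ->;
  rewrite ?v0 ?v1 ?v2 !inordK //=; lia.
Qed.

Local Open Scope ring_scope.

(** * Chebyshev quotients *)

(** With [s ^ 2 = z] and [u_k = U_k(1 / (2 s))], the recurrence
    [s u_(k+2) = u_(k+1) - s u_k] turns [r_k = u_(k-1) / (s u_k)] into
    [r_(k+1) (1 - z r_k) = 1]. The existence of a solution [r] of the latter
    implies that no denominator [u_k] vanishes, so that a separate study of the
    zeros of the [U_k] is avoided. *)
Lemma chebR_unique (F : fieldType) (z : F) (r : nat -> F) :
  (exists w : F, w ^+ 2 = z) -> z != 0 -> 2%:R != 0 :> F ->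
  r 0 = 0 -> (forall k, r k.+1 * (1 - z * r k) = 1) ->
  forall k, chebR k z = r k.
Proof.
move=> sqz z0 two0 r0 rS.
have sz : sqroot z ^+ 2 = z.
  by rewrite /sqroot; case: pselect => // e; apply: svalP (cid e).
have s0 : sqroot z != 0 by rewrite -sqrf_eq0 sz.
case=> [|k] /=; first by rewrite r0.
set s := sqroot z in sz s0 *; set t := _^-1.
have t2 : s * (2%:R * t) = 1 by rewrite /t; field; rewrite s0.
pose u j := (chebU F j).[t].
have uS j : u j.+2 = 2%:R * t * u j.+1 - u j.
  by rewrite /u /= !hornerE.
suff [uk0 uSk] : u k != 0 /\ s * u k.+1 * r k.+1 = u k.
  rewrite -/(u k) -/(u k.+1) -uSk [X in X / _]mulrC mulfK //.
  by move: uk0; rewrite -uSk mulf_eq0 => /norP[].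
elim: k => [|k [uk0 uSk]].
  have := rS 0; rewrite r0 mulr0 subr0 mulr1 => ->.
  by rewrite /u /= hornerZ hornerX -polyC1 hornerC t2 oner_eq0 mulr1.
split; first by move: uk0; rewrite -uSk !mulf_eq0 => /norP[/norP[]].
have -> : s * u k.+2 = u k.+1 * (1 - z * r k.+1).
  rewrite uS mulrBr [s * (_ * _ * _)]mulrA t2 mul1r -uSk -sz; ring.
by rewrite -mulrA [_ * r _]mulrC rS mulr1.
Qed.

(** * Two rounds of the parity system *)

Section Step.
Variables (F : fieldType) (x rho A B a b : F).
Hypothesis x0 : x != 0.
Hypothesis eA : A = 1 + x * (x * rho * A - B).
Hypothesis eB : B = x * (A + x * rho * B).
Hypothesis ea : a = 1 + x * (B * a - A * b).
Hypothesis eb : b = x * (A * a + B * b).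

(** Put [d = 1 - x^2 rho]. The first system reads [d A + x B = 1] and
    [d B = x A], whence [A] and [B]. The second one has diagonal coefficient
    [1 - x B = d A]; after division by [A] it is the first system again, up to
    the right-hand side: [d a + x b = 1 / A] and [d b = x a]. As [d / A] is
    [d^2 + x^2], this gives [a = 1] and [b = x / d]. *)
Lemma parity_step :
  [/\ (1 - x ^+ 2 * rho != 0) && ((1 - x ^+ 2 * rho) ^+ 2 + x ^+ 2 != 0),
      A = (1 - x ^+ 2 * rho) / ((1 - x ^+ 2 * rho) ^+ 2 + x ^+ 2),
      B = x / ((1 - x ^+ 2 * rho) ^+ 2 + x ^+ 2),
      a = 1 & b = x / (1 - x ^+ 2 * rho)].
Proof.
set d := 1 - x ^+ 2 * rho.
have dA : d * A + x * B = 1.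
  transitivity (1 + (A - (1 + x * (x * rho * A - B)))); first by rewrite /d; ring.
  by rewrite -eA subrr addr0.
have dB : d * B = x * A.
  transitivity (x * A + (B - x * (A + x * rho * B))); first by rewrite /d; ring.
  by rewrite -eB subrr addr0.
have ea' : (1 - x * B) * a + x * A * b = 1.
  transitivity (1 + (a - (1 + x * (B * a - A * b)))); first by ring.
  by rewrite -ea subrr addr0.
have eb' : (1 - x * B) * b = x * A * a.
  transitivity (x * A * a + (b - x * (A * a + B * b))); first by ring.
  by rewrite -eb subrr addr0.
have xB : 1 - x * B = d * A by rewrite -dA addrK.
rewrite xB in ea' eb'.
have A0 : A != 0.
  apply: contra_eq_neq ea' => ->.
  by rewrite !mulr0 !mul0r addr0 eq_sym oner_eq0.
have d0 : d != 0.
  apply/eqP => d0; move: dB; rewrite d0 mul0r => /esym/eqP.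
  by rewrite mulf_eq0 (negPf x0) (negPf A0).
have DA : (d ^+ 2 + x ^+ 2) * A = d.
  transitivity (d * (d * A + x * B) + x * (x * A - d * B)); first by ring.
  by rewrite dA dB subrr mulr0 addr0 mulr1.
have D0 : d ^+ 2 + x ^+ 2 != 0.
  by apply: contraNneq d0 => D0; rewrite -DA D0 mul0r.
have edb : d * b = x * a.
  apply: (mulfI A0); rewrite mulrA [A * d]mulrC eb'; ring.
have a1 : a = 1.
  apply: (mulfI d0); rewrite mulr1 -[RHS]mulr1 -ea' -{1}DA.
  transitivity (A * d * d * a + A * x * (x * a)); first by ring.
  rewrite -edb; ring.
split=> //; first by rewrite d0 D0.
- by apply: (mulIf D0); rewrite divfK // mulrC.
- apply: (mulIf D0); rewrite divfK //; apply: (mulfI d0).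
  by rewrite mulrA dB -[in RHS]DA; ring.
- by apply: (mulIf d0); rewrite divfK // mulrC edb a1 mulr1.
Qed.
End Step.

Lemma parity_sum (F : fieldType) (x d : F) : d != 0 -> d ^+ 2 + x ^+ 2 != 0 ->
  d / (d ^+ 2 + x ^+ 2) + x / (d ^+ 2 + x ^+ 2) =
  (1 + x * d^-1) * d^-1 / (1 + x ^+ 2 * d^-1 ^+ 2).
Proof. by move=> d0 D0; field; rewrite D0 d0. Qed.

(** * Generating functions *)

(** The series [\sum_n a_n x^n], in a field of series in [sqrt x]. *)
Definition gf (a : nat -> rat) : K :=
  tofrac (Fps (fun n => if odd n then 0 else a n./2)).

Lemma eq_gf a b : a =1 b -> gf a = gf b.
Proof. by move=> eab; congr (tofrac (Fps _)); apply: funext => n; rewrite eab. Qed.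

Lemma gfD a b : gf (fun n => a n + b n) = gf a + gf b.
Proof.
rewrite /gf -[RHS]rmorphD; congr tofrac; apply: fpsP => n /=.
by case: odd; rewrite ?addr0.
Qed.

Lemma gfN a : gf (fun n => - a n) = - gf a.
Proof.
rewrite /gf -[RHS]rmorphN; congr tofrac; apply: fpsP => n /=.
by case: odd; rewrite ?oppr0.
Qed.

Lemma gf0 : gf (fun=> 0) = 0.
Proof.
rewrite /gf -[RHS](rmorph0 (@tofrac (fps rat))); congr tofrac; apply: fpsP => n /=.
by case: odd.
Qed.

(** Products of series in [x] are computed on series in [sqrt x], where only
    the even powers of [sqrt x] contribute. *)
Lemma sum_even_index (V : nmodType) (G : nat -> V) m :
  \sum_(i < m.*2.+1) (if odd i then 0 else G i./2) = \sum_(i < m.+1) G i.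
Proof.
elim: m => [|m IH]; first by rewrite !big_ord1.
rewrite doubleS [LHS]big_ord_recr /= [in LHS]big_ord_recr IH /= odd_double.
by rewrite addr0 doubleK [RHS]big_ord_recr.
Qed.

Lemma gfM a b :
  gf a * gf b = gf (fun n => \sum_(i < n.+1) a i * b (n - i)%N).
Proof.
rewrite /gf -[LHS]rmorphM; congr tofrac; apply: fpsP => n.
transitivity (\sum_(i < n.+1) (if odd i then 0 else a i./2) *
    (if odd (n - i) then 0 else b (n - i)./2)) => //=.
case: (boolP (odd n)) => on.
  apply: big1 => i _; rewrite oddB ?on; last by rewrite -ltnS.
  by case: odd => /=; rewrite ?mul0r ?mulr0.
have {on} [m ->] : exists m, n = m.*2 by exists n./2; rewrite even_halfK.
rewrite doubleK -(sum_even_index (fun i => a i * b (m - i)%N)).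
apply: eq_bigr => i _; have lei : (i <= m.*2)%N by rewrite -ltnS.
rewrite oddB // odd_double; case: (boolP (odd i)) => oi /=; first by rewrite mul0r.
by rewrite -{2}[i : nat]even_halfK // -doubleB doubleK.
Qed.

Lemma sqrtx_neq0 : sqrtx != 0.
Proof.
rewrite tofrac_eq0; apply/eqP => /(congr1 (fun f => fcoef f 1)) /eqP.
by rewrite /= oner_eq0.
Qed.

Lemma x_neq0 : x != 0.
Proof. by rewrite expf_neq0 // sqrtx_neq0. Qed.

Lemma two_neq0 : 2%:R != 0 :> K.
Proof.
rewrite -(rmorph_nat (@tofrac (fps rat))) tofrac_eq0; apply/eqP.
by move/(congr1 (fun f => fcoef f 0)).
Qed.

Lemma fcoef_XM (f : fps rat) n :
  fcoef (Fps (fun n => (n == 1%N)%:R) * f) n =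
  if n is n'.+1 then fcoef f n' else 0.
Proof.
transitivity (\sum_(i < n.+1) (i == 1 :> nat)%:R * fcoef f (n - i)%N) => //.
case: n => [|n]; first by rewrite big_ord1 mul0r.
rewrite big_ord_recl mul0r add0r big_ord_recl mul1r subn1 big1 ?addr0 //.
by move=> i _; rewrite mul0r.
Qed.

Lemma gfS a (c : nat) : a 0 = c%:R -> gf a = c%:R + x * gf (fun n => a n.+1).
Proof.
move=> a0; rewrite /gf /x /sqrtx expr2 -mulrA -!rmorphM.
rewrite -(rmorph_nat (@tofrac (fps rat))) -[RHS]rmorphD; congr tofrac; apply: fpsP => n.
set X := Fps (fun n => (n == 1%N)%:R); set F := Fps (fun n => if odd n then 0 else a n./2.+1).
transitivity (fcoef (c%:R : fps rat) n + fcoef (X * (X * F)) n) => //.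
have cn : fcoef (c%:R : fps rat) n = if n is 0 then c%:R else 0.
  elim: c {a0} => [|c IH]; first by case: n.
  rewrite !mulrS -/(fps_add _ _) /= -[fcoef (_ *+ c) n]/(fcoef (c%:R : fps rat) n).
  by rewrite IH; case: n {IH} => [|n] /=; rewrite ?addr0.
(* a variable in place of X * F keeps its coefficients from being unfolded *)
have := fcoef_XM F; rewrite -/X; move: (X * F) => G GE.
rewrite cn fcoef_XM; case: n {cn} => [|[|n]]; rewrite ?GE ?add0r ?addr0 //=.
by rewrite negbK.
Qed.

(** * The unsigned and the signed series *)

Definition at_parity (p : bool) (m : nat -> rat) (n : nat) : rat :=
  if odd n == p then m n else 0.

Lemma gf_parity m : gf m = gf (at_parity false m) + gf (at_parity true m).
Proof.
rewrite -gfD; apply: eq_gf => n; rewrite /at_parity.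
by case: odd; rewrite ?add0r ?addr0.
Qed.

Lemma invgf1_series k :
  gf (invgf 1 k.+1) = 1 + x * (gf (invgf 1 k) * gf (invgf 1 k.+1)).
Proof.
rewrite [LHS](@gfS _ 1) ?invgfS0 // gfM; congr (_ + _ * _); apply: eq_gf => n.
by rewrite invgfSS; apply: eq_bigr => i _; rewrite expr1n mul1r.
Qed.

Definition even_part k := gf (at_parity false (invgf (-1) k)).
Definition odd_part k := gf (at_parity true (invgf (-1) k)).

(** The sign [(-1)^((i+1) j)] is negative exactly when [i] is even and [j] is
    odd. The parity of [n + 1] on the left is even iff [i] and [j] have
    opposite parities, where [i + j = n]; the two ways give the two products,
    with opposite signs. *)
Lemma even_part_rec k : even_part k.+1 =
  1 + x * (odd_part k * even_part k.+1 - even_part k * odd_part k.+1).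
Proof.
rewrite {1}/even_part [LHS](@gfS _ 1) /at_parity /= ?invgfS0 //.
rewrite !gfM -gfN -gfD; congr (_ + _ * _); apply: eq_gf => n.
rewrite invgfSS -sumrN -big_split /at_parity /=.
case: (boolP (odd n)) => on /=; last first.
  rewrite big1 // => i _; rewrite oddB; last by rewrite -ltnS.
  by rewrite (negPf on); case: odd; rewrite /= ?mul0r ?mulr0 ?oppr0 ?addr0.
apply: eq_bigr => i _; rewrite -signr_odd oddM /= oddB; last by rewrite -ltnS.
rewrite on; case: odd => /=; rewrite ?mul0r ?mulr0 ?oppr0 ?addr0 ?add0r.
  by rewrite mul1r.
by rewrite expr1 mulN1r.
Qed.

(** Here [i] and [j] have the same parity, and the sign is always positive. *)
Lemma odd_part_rec k : odd_part k.+1 =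
  x * (even_part k * even_part k.+1 + odd_part k * odd_part k.+1).
Proof.
rewrite {1}/odd_part [LHS](@gfS _ 0) /at_parity //= add0r.
rewrite !gfM -gfD; congr (_ * _); apply: eq_gf => n.
rewrite invgfSS -big_split /at_parity /=.
case: (boolP (odd n)) => on /=.
  rewrite big1 // => i _; rewrite oddB; last by rewrite -ltnS.
  by rewrite on; case: odd; rewrite /= ?mul0r ?mulr0 ?addr0.
apply: eq_bigr => i _; rewrite -signr_odd oddM /= oddB; last by rewrite -ltnS.
rewrite (negPf on); case: odd => /=; rewrite ?mul0r ?mulr0 ?addr0 ?add0r;
by rewrite mul1r.
Qed.

Lemma parts0 : even_part 0 = 0 /\ odd_part 0 = 0.
Proof.
by split; rewrite -[RHS]gf0; apply: eq_gf => n; rewrite /at_parity invgf0 if_same.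
Qed.

(** At odd levels the even part is [1], and [rho] is the odd part divided by
    [x]. *)
Lemma two_steps k : even_part k.*2.+1 = 1 ->
  let d := 1 - x * odd_part k.*2.+1 in
  [/\ (d != 0) && (d ^+ 2 + x ^+ 2 != 0),
      even_part k.*2.+2 = d / (d ^+ 2 + x ^+ 2),
      odd_part k.*2.+2 = x / (d ^+ 2 + x ^+ 2),
      even_part k.*2.+3 = 1 & odd_part k.*2.+3 = x / d].
Proof.
move=> e1; set b := odd_part k.*2.+1.
have eb : b = x * (b / x) by rewrite mulrC divfK // x_neq0.
have := @parity_step K x (b / x) (even_part k.*2.+2) (odd_part k.*2.+2)
  (even_part k.*2.+3) (odd_part k.*2.+3) x_neq0.
rewrite expr2 -[x * x * _]mulrA -eb; apply.
- by rewrite [LHS]even_part_rec e1 mul1r.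
- by rewrite [LHS]odd_part_rec e1 mul1r.
- exact: even_part_rec.
- exact: odd_part_rec.
Qed.

Lemma even_part_odd k : even_part k.*2.+1 = 1.
Proof.
elim: k => [|k IH]; last by case: (two_steps IH).
by rewrite even_part_rec !parts0.1 !parts0.2 !mul0r subrr mulr0 addr0.
Qed.

Lemma chebR_x k : chebR k x = gf (invgf 1 k).
Proof.
rewrite (@chebR_unique _ x (fun k => gf (invgf 1 k))) //.
- by exists sqrtx.
- exact: x_neq0.
- exact: two_neq0.
- by rewrite -[RHS]gf0; apply: eq_gf => n; rewrite invgf0.
by move=> j; rewrite mulrBr mulr1 {1}invgf1_series; ring.
Qed.

Lemma chebR_x2 k : x * chebR k (x ^+ 2) = odd_part k.*2.+1.
Proof.
pose r j := odd_part j.*2.+1 / x.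
have rE j : x * r j = odd_part j.*2.+1 by rewrite mulrC divfK // x_neq0.
rewrite (@chebR_unique _ _ r) //.
- by exists x.
- by rewrite expf_neq0 // x_neq0.
- exact: two_neq0.
- by rewrite /r odd_part_rec !parts0.1 !parts0.2 !mul0r addr0 mulr0 mul0r.
move=> j; rewrite expr2 -[x * x * _]mulrA rE /r.
have [/andP[d0 _] _ _ _ ->] := two_steps (even_part_odd j).
by rewrite [x / _]mulrC mulfK ?x_neq0 // mulVf.
Qed.

Lemma signed_gf_odd k :
  gf (invgf (-1) k.*2.+1) = x * chebR k (x ^+ 2) + 1.
Proof. by rewrite gf_parity -/(even_part _) even_part_odd chebR_x2 addrC. Qed.

Lemma signed_gf_even k : gf (invgf (-1) k.+1.*2) =
  (1 + x * chebR k.+1 (x ^+ 2)) * chebR k.+1 (x ^+ 2) /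
    (1 + x ^+ 2 * chebR k.+1 (x ^+ 2) ^+ 2).
Proof.
have := two_steps (even_part_odd k); set d := 1 - _.
case=> /andP[d0 D0] eE eO _ b3.
have -> : chebR k.+1 (x ^+ 2) = d^-1.
  by apply: (mulfI x_neq0); rewrite chebR_x2 b3.
rewrite gf_parity -/(even_part _) -/(odd_part _) eE eO.
exact: parity_sum.
Qed.

(** * Even and odd permutations *)

(** Each permutation counts as [e] to the power of its parity, for any square
    root [e] of [1]. *)
Lemma signed_count (T : comNzRingType) (e : T) k n : e ^+ 2 = 1 ->
  (even_count (idpat k) n)%:R + e * (odd_count (idpat k) n)%:R = invgf e k n.
Proof.
move=> e2.
have eE m : e ^+ m = e ^+ odd m.
  by rewrite -{1}[m]odd_double_half exprD -muln2 mulnC exprM e2 expr1n mulr1.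
rewrite /invgf big_filter -(perm_big _ (perm_words n)) big_map big_enum_cond /=.
rewrite (bigID (fun s : 'S_n => odd_perm s)) /= addrC; congr (_ + _).
  rewrite /even_count -sumr_const; apply: eq_big => [s|s].
    by rewrite inE /avoids contains_pat132 contains_idpat andbC.
  by rewrite inE eE -odd_perm_word => /andP[/negPf ->].
rewrite /odd_count -sumr_const mulr_sumr; apply: eq_big => [s|s].
  by rewrite inE /avoids contains_pat132 contains_idpat andbC.
by rewrite inE eE -odd_perm_word => /andP[-> _]; rewrite mulr1 expr1.
Qed.

Lemma count_gf k :
  even_gf (idpat k) = 2%:R^-1 * (chebR k x + gf (invgf (-1) k)) /\
  odd_gf (idpat k) = 2%:R^-1 * (chebR k x - gf (invgf (-1) k)).
Proof.
pose E := gf (fun n => (even_count (idpat k) n)%:R).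
pose O := gf (fun n => (odd_count (idpat k) n)%:R).
have ogfE a : ogf a = gf (fun n => (a n)%:R) by [].
have EO : chebR k x = E + O.
  rewrite chebR_x -gfD; apply: eq_gf => n.
  by rewrite -signed_count ?expr1n // mul1r.
have EmO : gf (invgf (-1) k) = E - O.
  rewrite -gfN -gfD; apply: eq_gf => n.
  by rewrite -signed_count ?sqrrN ?expr1n // mulN1r.
rewrite EO EmO /even_gf /odd_gf !ogfE -/E -/O.
by split; field; rewrite two_neq0.
Qed.

Theorem theorem2p11 (k : nat) (hk : (1 <= k)%N) :
  ((even_gf (idpat (2 * k - 1)) =
      2%:R^-1 * (chebR (2 * k - 1) x + x * chebR (k - 1) (x ^+ 2) + 1)) /\
   (even_gf (idpat (2 * k)) =
      2%:R^-1 * (chebR (2 * k) x +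
        (1 + x * chebR k (x ^+ 2)) * chebR k (x ^+ 2) /
          (1 + x ^+ 2 * chebR k (x ^+ 2) ^+ 2)))) /\
  ((odd_gf (idpat (2 * k - 1)) =
      2%:R^-1 * (chebR (2 * k - 1) x - x * chebR (k - 1) (x ^+ 2) - 1)) /\
   (odd_gf (idpat (2 * k)) =
      2%:R^-1 * (chebR (2 * k) x -
        (1 + x * chebR k (x ^+ 2)) * chebR k (x ^+ 2) /
          (1 + x ^+ 2 * chebR k (x ^+ 2) ^+ 2)))).
Proof.
case: k hk => [//|k] _; have [eO oO] := count_gf k.*2.+1.
have [eE oE] := count_gf k.+1.*2.
rewrite mul2n subn1 subn1 eE oE eO oO signed_gf_even signed_gf_odd.
by rewrite opprD !addrA.
Qed.
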